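(* Assume the Singular Cardinal Hypothesis. Let $\kappa$ be a cardinal, $D$ an ultrafilter on $\kappa$, and $(A_i)_{i\in\kappa}$ infinite Boolean algebras with $2^\kappa<\lambda_i=\pi A_i$ for all $i\in\kappa$. Let $A=\prod_{i\in\kappa}A_i/D$. Then $\pi A=\big|\prod_{i\in\kappa}\lambda_i/D\big|$.
   Context: The Singular Cardinal Hypothesis (SCH): for every cardinal $\lambda$, if $2^{\operatorname{cf}\lambda}<\lambda$ then $\lambda^{\operatorname{cf}\lambda}=\lambda^+$. For a Boolean algebra $A$, $\pi A$ is the least cardinality of a set $X\subseteq A\setminus\{0\}$ such that every nonzero element of $A$ is above some element of $X$. $\prod_{i\in\kappa}\lambda_i/D$ is the ultraproduct of the cardinals $\lambda_i$ (the set of $D$-classes of functions $f$ on $\kappa$ with $f(i)<\lambda_i$). *)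

(* Defs.v *)
From HB Require Import structures.
From mathcomp Require Import all_boot all_order.
From mathcomp Require Import boolp classical_sets functions cardinality filter.
Set Implicit Arguments. Unset Strict Implicit. Unset Printing Implicit Defensive.
Import Order.TTheory.
Local Open Scope classical_set_scope.
Local Open Scope card_scope.

Definition card_lt T U (A : set T) (B : set U) : Prop := A #<= B /\ ~ (A #= B).

(* R is a strict well-order on T of initial-ordinal type: every proper initial
   segment has cardinality < |T|.  (T, R) is then "the cardinal |T|" seen as an
   initial ordinal. *)
Definition initial_wellorder T (R : T -> T -> Prop) : Prop :=
  [/\ (forall x, ~ R x x),
      (forall x y z, R x y -> R y z -> R x z),
      (forall x y, [\/ R x y, x = y | R y x]),
      well_founded R &
      (forall x, card_lt [set y | R y x] [set: T])].

Definition cofinal T (R : T -> T -> Prop) (S : set T) : Prop :=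
  forall t, exists2 s, S s & (R t s \/ t = s).

Definition cf_is (T C : Type) : Prop :=
  exists R : T -> T -> Prop, initial_wellorder R /\
    (exists2 S, cofinal R S & S #= [set: C]) /\
    (forall S, cofinal R S -> [set: C] #<= S).

Definition succ_is (T M : Type) : Prop :=
  card_lt [set: T] [set: M] /\
  forall N : Type, card_lt [set: T] [set: N] -> [set: M] #<= [set: N].

Definition SCH : Prop :=
  forall (T C M : Type), infinite_set [set: T] -> cf_is T C ->
    card_lt [set: set C] [set: T] -> succ_is T M ->
    [set: C -> T] #= [set: M].

Definition pi_dense T (S : set T) (le : T -> T -> Prop) (bot : T) (X : set T) :=
  X `<=` S `\` [set bot] /\
  forall a, S a -> a <> bot -> exists2 x, X x & le x a.

Definition pi_is T U (S : set T) (le : T -> T -> Prop) (bot : T) (K : set U) :=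
  (exists2 X, pi_dense S le bot X & X #= K) /\
  (forall X, pi_dense S le bot X -> K #<= X).

Definition piBA d (B : ctbDistrLatticeType d) U (K : set U) :=
  pi_is [set: B] (fun x y => (x <= y)%O) \bot%O K.

Section Ultra.
Variables (I : Type) (D : set_system I) (F : I -> Type).

Definition uprod := forall i, F i.
Definition ueq (f g : uprod) : Prop := D [set i | f i = g i].
Definition uclass (f : uprod) : set uprod := [set g | ueq f g].
Definition ucarrier : set (set uprod) := [set C | exists f, C = uclass f].
End Ultra.
Arguments ucarrier {I} D F.
Arguments uclass {I} D {F} f.

Definition ule I (D : set_system I) d (A : I -> ctbDistrLatticeType d)
  (C C' : set (uprod A)) : Prop :=
  exists f g, [/\ C = uclass D f, C' = uclass D g & D [set i | (f i <= g i)%O]].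
Arguments ule {I} D {d} A C C'.
Definition ubot I (D : set_system I) d (A : I -> ctbDistrLatticeType d)
  : set (uprod A) := uclass D (fun i => \bot%O).
Arguments ubot {I} D {d} A.

Definition piUltra I (D : set_system I) d (A : I -> ctbDistrLatticeType d)
  U (K : set U) :=
  pi_is (ucarrier D A) (@ule I D d A) (ubot D A) K.

(* Main.v *)
(** Let [X] be dense in the ultraproduct, well-ordered in its initial type, and
let [S i] be the initial segment of those [x] below which there are fewer than
[lambda_i] elements. If some [h] in [prod_i S i] were almost everywhere above
every [x] in [X], then fewer than [lambda_i] coordinates [x_i] with [x < h i]
would have to be avoided at [i], and a choice of nonzero [a_i] above none of
them gives a class with no element of [X] below it. (If [|X| < lambda_i] almost
everywhere, all of [X] can be avoided this way.) Hence every such [h] is almost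
everywhere bounded by a constant [x], so that
[|prod_i lambda_i / D| <= sum_(x in X) |seg x| ^ kappa], and by SCH the
right-hand side is at most [|X|], since [|seg x| < |X|] and [2 ^ kappa < |X|]. *)

Require Import Defs.
From HB Require Import structures.
From mathcomp Require Import all_boot all_order.
From mathcomp Require Import boolp classical_sets functions cardinality filter.
From mathcomp Require wochoice.
Set Implicit Arguments. Unset Strict Implicit. Unset Printing Implicit Defensive.
Import Order.Theory.
Local Open Scope classical_set_scope.
Local Open Scope card_scope.


(** * Injections and comparison of cardinals *)

(** Choosing a related [y] for each [x] gives an injection. A relation is convenient when the map is
    given by cases or on equivalence classes. *)
Lemma card_le_rel T U (A : set T) (B : set U) (r : T -> U -> Prop) :
  (forall x, A x -> exists2 y, B y & r x y) ->
  (forall x x' y, A x -> A x' -> r x y -> r x' y -> x = x') -> A #<= B.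
Proof.
move=> tot inj.
have /choice[f fP] : forall x : A, exists y : B, r (val x) (val y).
  move=> [x xA]; have [y By rxy] := tot x (set_mem xA).
  by exists (SigSub (mem_set By)).
apply/card_leP; have /Pinj[g _] : set_inj [set: A] f.
  move=> x x' _ _ ffx; apply: val_inj.
  by apply: (inj _ _ (val (f x)) (set_valP x) (set_valP x') (fP x)); rewrite ffx.
by squash (totalfun_ setT g).
Qed.

Lemma card_le_fun T U (A : set T) (B : set U) (f : T -> U) :
  (forall x, A x -> B (f x)) ->
  (forall x x', A x -> A x' -> f x = f x' -> x = x') -> A #<= B.
Proof.
move=> fAB finj; apply: (@card_le_rel _ _ _ _ (fun x y => f x = y)).
  by move=> x Ax; exists (f x); [exact: fAB|].
by move=> x x' y Ax Ax' <- /esym; exact: finj.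
Qed.

(** A point of [A] serves as default value, so that the injection between subtypes becomes a total
    function on [T] with all values in [B]. *)
Lemma card_le_inj T U (A : set T) (B : set U) :
  A !=set0 -> A #<= B ->
  exists2 f : T -> U, forall x, B (f x) &
    forall x x', A x -> A x' -> f x = f x' -> x = x'.
Proof.
move=> [a Aa] /card_leP[f].
pose g x : A := match pselect (A x) with
  | left Ax => SigSub (mem_set Ax) | right _ => SigSub (mem_set Aa) end.
have gE x : A x -> val (g x) = x by rewrite /g; case: pselect.
exists (fun x => val (f (g x))) => [x|x x' Ax Ax' /val_inj ffx].
  exact: set_valP.
by rewrite -(gE x)// -(gE x')//; congr val; apply: (@inj _ _ _ f); rewrite ?inE.
Qed.

(** * Well-orders and comparability of cardinals *)

Definition trichotomous T (R : T -> T -> Prop) :=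
  forall x y, [\/ R x y, x = y | R y x].

Lemma wf_irrefl T (R : T -> T -> Prop) : well_founded R -> forall x, ~ R x x.
Proof. by move=> wfR x; elim/(well_founded_ind wfR): x => x IH Rxx; exact: (IH x). Qed.

Lemma wf_min T (R : T -> T -> Prop) (P : set T) : well_founded R ->
  P !=set0 -> exists2 m, P m & forall y, R y m -> ~ P y.
Proof.
move=> wfR [x Px]; apply: contrapT => nomin; move: Px.
elim/(well_founded_ind wfR): x => x IH Px.
by apply: nomin; exists x => // y /IH.
Qed.

(** Transfinite recursion: send each [x] in [A] to an element of [B] not yet used. If none were
    left, [B] would inject into the part of [A] below [x]. *)
Lemma wo_card_le T U (R : T -> T -> Prop) (A : set T) (B : set U) :
  well_founded R -> trichotomous R ->
  (forall x, A x -> ~ (B #<= A `&` [set y | R y x])) -> A #<= B.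
Proof.
move=> wfR triR small.
have [->|/set0P[a Aa]] := eqVneq A set0; first exact: card_ge0.
have [u0 Bu0] : B !=set0.
  by apply/set0P/eqP => B0; apply: (small _ Aa); rewrite B0; exact: card_ge0.
pose old x (rec : forall y, R y x -> U) :=
  [set u | exists y (Ryx : R y x), A y /\ rec y Ryx = u].
(* The default [u0] is never reached for [x] in [A]. *)
pose F x rec := match pselect (exists u, B u /\ ~ old x rec u) with
  | left ex => projT1 (cid ex) | right _ => u0 end.
pose f := Fix wfR (fun=> U) F.
have fE x : f x = F x (fun y _ => f y).
  apply: (Fix_eq wfR (fun=> U) F) => {}x g h gh.
  by congr F; apply: functional_extensionality_dep => y; apply: functional_extensionality_dep.
have fP x : A x -> B (f x) /\ (forall y, A y -> R y x -> f y <> f x).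
  move=> Ax; rewrite [f x]fE /F; case: pselect => [ex|nex]; last first.
    exfalso; apply: (small _ Ax).
    apply: card_le_trans (card_image_le f _); apply: subset_card_le => u Bu.
    apply: contrapT => nu; apply: nex; exists u; split=> // -[y [Ryx [Ay fy]]].
    by apply: nu; exists y.
  case: (cid ex) => u /= [Bu nu]; split=> // y Ay Ryx fyu.
  by apply: nu; exists y, Ryx.
apply: (@card_le_fun _ _ _ _ f) => [x /fP[]//|x y Ax Ay fxy].
have [Rxy|//|Ryx] := triR x y.
- by have [_ /(_ x Ax Rxy)] := fP y Ay.
- by have [_ /(_ y Ay Ryx)] := fP x Ax; rewrite fxy.
Qed.

(** The well-ordering principle yields a reflexive order in which every nonempty set has a unique
    minimum; the negation of its converse is the strict order. *)
Lemma wellorder_exists T : exists R : T -> T -> Prop,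
  [/\ forall x y z, R x y -> R y z -> R x z, trichotomous R & well_founded R].
Proof.
elim/Peq: T => T.
have [R woR] := wochoice.well_ordering_principle T.
have minR (P : set T) : P !=set0 -> exists2 m, P m & forall y, P y -> R m y.
  move=> [x Px]; have [|m [[Pm mP] _]] := woR (fun y => `[< P y >]).
    by exists x; exact/asboolP.
  by exists m; [exact/asboolP | move=> y Py; apply: mP; exact/asboolP].
have anti x y : R x y -> R y x -> x = y.
  move=> Rxy Ryx.
  (* Both [x] and [y] are minima of the pair, so uniqueness of the minimum identifies them. *)
  have [|m [mP um]] := woR (fun z => `[< z = x \/ z = y >]).
    by exists x; apply/asboolP; left.
  have Rxx : R x x by have [m' -> Rm] := minR [set x] (ex_intro _ x erefl); exact: Rm.
  have Ryy : R y y by have [m' -> Rm] := minR [set y] (ex_intro _ y erefl); exact: Rm.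
  have mx : m = x.
    apply: um; split; first by apply/asboolP; left.
    by move=> z /asboolP[] ->.
  rewrite -mx; apply: um; split; first by apply/asboolP; right.
  by move=> z /asboolP[] ->.
have tot x y : R x y \/ R y x.
  have [|m [->|->] mP] := minR [set z | z = x \/ z = y]; first by exists x; left.
    by left; apply: mP; right.
  by right; apply: mP; left.
exists (fun x y => ~ R y x); split.
- move=> x y z nRyx nRzy Rzx.
  have [|m [->|[->|->]] mP] := minR [set w | w = x \/ w = y \/ w = z].
  + by exists x; left.
  + have xz : x = z by apply: anti => //; apply: mP; right; right.
    by apply: nRzy; rewrite -xz; apply: mP; right; left.
  + by apply: nRyx; apply: mP; left.
  + by apply: nRzy; apply: mP; right; left.
- move=> x y; have [Rxy|nRxy] := pselect (R x y); last by apply: Or33.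
  have [Ryx|nRyx] := pselect (R y x); last by apply: Or31.
  by apply: Or32; exact: anti.
- move=> x; apply: contrapT => nAx.
  have [m nAm mP] := minR [set x | ~ Acc (fun x y => ~ R y x) x] (ex_intro _ x nAx).
  by apply: nAm; constructor => y nRmy; apply: contrapT => /mP.
Qed.

Lemma card_le_totalP T U (A : set T) (B : set U) : ~ (B #<= A) -> A #<= B.
Proof.
move=> nBA; have [R [_ triR wfR]] := wellorder_exists T.
apply: wo_card_le wfR triR _ => x Ax BA; apply: nBA.
by apply: card_le_trans BA (subset_card_le _) => y [].
Qed.

(** If some member of [F] injects into an initial segment, a member injecting into the earliest such
    segment is least. Otherwise every member is least. *)
Lemma card_min T (F : set (set T)) : F !=set0 ->
  exists2 A, F A & forall B, F B -> A #<= B.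
Proof.
move=> [A FA]; have [R [_ triR wfR]] := wellorder_exists T.
have [[x Px]|nP] :=
    pselect (exists x, exists2 B, F B & B #<= [set y | R y x]).
  have [m [B FB Bm] mmin] := wf_min wfR
    (ex_intro (fun x => exists2 B, F B & B #<= [set y | R y x]) x Px).
  exists B => // C FC; apply: card_le_trans Bm _.
  apply: wo_card_le wfR triR _ => y Rym CB; apply: (mmin y Rym).
  by exists C => //; apply: card_le_trans CB (subset_card_le _) => z [].
exists A => // B FB; apply: wo_card_le wfR triR _ => x _ Bx; apply: nP.
by exists x, B => //; apply: card_le_trans Bx (subset_card_le _) => z [].
Qed.


(** * Strict inequality and initial well-orders *)

Lemma card_ltPn T U (A : set T) (B : set U) : card_lt A B <-> ~ (B #<= A).
Proof.
split=> [[AB nAB] BA|nBA]; first exact: nAB (Cantor_Bernstein AB BA).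
split=> [|/card_eqPle[]//]; exact: card_le_totalP.
Qed.

(** If some segment is as large as [T], the order is pulled back along an injection of [T] into the
    earliest such segment; all earlier segments are smaller than [T]. *)
Lemma initial_wellorder_exists T :
  exists R : T -> T -> Prop, initial_wellorder R.
Proof.
have [R [trR triR wfR]] := wellorder_exists T.
have [big|small] := pselect (exists x, [set: T] #<= [set y | R y x]); last first.
  exists R; split=> // [x|x]; first exact: wf_irrefl wfR x.
  by apply/card_ltPn => Tx; apply: small; exists x.
have [m Tm mmin] := wf_min wfR big.
have [g gm ginj] := card_le_inj (ex_intro _ m I) Tm.
exists (fun x y => R (g x) (g y)); split.
- by move=> x; exact: wf_irrefl wfR _.
- by move=> x y z; exact: trR.
- move=> x y; have [Rxy|gxy|Ryx] := triR (g x) (g y).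
  + exact: Or31.
  + by apply: Or32; exact: ginj.
  + exact: Or33.
- suff H z x : g x = z -> Acc (fun x y => R (g x) (g y)) x by move=> x; exact: H erefl.
  elim/(well_founded_ind wfR): z x => z IH x gx.
  by constructor => y Ryx; apply: IH erefl; rewrite -gx.
- move=> x; apply/card_ltPn => Tx; apply: (mmin (g x)) (gm x) _ => /=.
  apply: card_le_trans Tx (card_le_fun (f := g) _ _) => // y z _ _.
  exact: ginj.
Qed.

(** Hilbert's hotel: along a sequence [e] in [A], the point [x] takes the place of [e 0] and each
    [e n] moves to [e n.+1]. *)
Lemma infinite_setU1_le T (A : set T) x : infinite_set A -> A `|` [set x] #<= A.
Proof.
move=> /infiniteP /card_le_inj[|e eA einj]; first by exists 0.
have {}einj m n : e m = e n -> m = n by exact: einj.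
have [xA|xA] := pselect (A x).
  by apply: subset_card_le => y [//|->].
pose r z y := [\/ z = x /\ y = e 0, exists2 n, z = e n & y = e n.+1 |
  [/\ z <> x, forall n, z <> e n & y = z]].
apply: (@card_le_rel _ _ _ _ r).
  move=> z Az; have [->|zx] := pselect (z = x).
    by exists (e 0) => //; apply: Or31.
  have {}Az : A z by case: Az.
  have [[n zn]|nz] := pselect (exists n, z = e n).
    by exists (e n.+1) => //; apply: Or32; exists n.
  by exists z => //; apply: Or33; split=> // n zn; apply: nz; exists n.
move=> z z' y _ _.
move=> [[-> ->]|[n -> ->]|[zx ze ->]] [[-> ey]|[m -> ey]|[zx' ze' ey]] //.
- by have /einj := ey.
- by case: (ze' 0).
- by have /einj := ey.
- by have /einj[->] := ey.
- by case: (ze' n.+1).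
- by case: (ze 0).
- by case: (ze m.+1).
Qed.

Lemma initial_segle_lt T (R : T -> T -> Prop) x :
  initial_wellorder R -> infinite_set [set: T] ->
  ~ ([set: T] #<= [set y | R y x \/ y = x]).
Proof.
move=> [_ _ _ _ iR] infT.
have -> : [set y | R y x \/ y = x] = [set y | R y x] `|` [set x].
  by rewrite predeqE.
have [fin|inf] := pselect (finite_set [set y | R y x]); move=> Tx.
  apply: infT; apply: card_le_finite Tx _.
  by rewrite finite_setU; split => //; exact: finite_set1.
have /card_ltPn := iR x; apply.
exact: card_le_trans Tx (infinite_setU1_le x inf).
Qed.

(** * The square of an infinite set *)

Lemma card_setX_le T T' U U' (A : set T) (A' : set T') (B : set U) (B' : set U') :
  A #<= A' -> B #<= B' -> A `*` B #<= A' `*` B'.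
Proof.
move=> AA BB; have [->|/set0P[[a b] [Aa Bb]]] := eqVneq (A `*` B) set0.
  exact: card_ge0.
have [f fA finj] := card_le_inj (ex_intro _ a Aa) AA.
have [g gB ginj] := card_le_inj (ex_intro _ b Bb) BB.
apply: (@card_le_fun _ _ _ _ (fun p => (f p.1, g p.2))) => [p _|].
  by split; [exact: fA|exact: gB].
move=> [x y] [x' y'] [/= Ax By] [/= Ax' By'] [fx gy].
by rewrite (finj _ _ Ax Ax' fx) (ginj _ _ By By' gy).
Qed.

(* Goedel's canonical order: compare maxima first, so that the pairs below [p]
   all lie in a square over a proper initial segment. *)
Definition pair_max T (R : T -> T -> Prop) (p : T * T) : T :=
  if `[< R p.1 p.2 >] then p.2 else p.1.

Definition goedel T (R : T -> T -> Prop) (p q : T * T) : Prop :=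
  R (pair_max R p) (pair_max R q) \/ pair_max R p = pair_max R q /\
  (R p.1 q.1 \/ p.1 = q.1 /\ R p.2 q.2).

(** Nested induction on the maximum, then the first, then the second coordinate. *)
Lemma goedel_wf T (R : T -> T -> Prop) : well_founded R -> well_founded (goedel R).
Proof.
move=> wfR.
suff H m a b : pair_max R (a, b) = m -> Acc (goedel R) (a, b).
  by move=> [a b]; exact: H erefl.
elim/(well_founded_ind wfR): m a b => m IHm a.
elim/(well_founded_ind wfR): a => a IHa b.
elim/(well_founded_ind wfR): b => b IHb mE.
constructor => -[a' b']; rewrite /goedel mE /=.
move=> [Rm|[m'E [Ra|[aE Rb]]]].
- exact: IHm Rm _ _ erefl.
- exact: IHa.
- by rewrite aE; apply: IHb => //; rewrite -aE.
Qed.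

Lemma goedel_tri T (R : T -> T -> Prop) : trichotomous R -> trichotomous (goedel R).
Proof.
move=> triR [a b] [a' b']; rewrite /goedel /=.
have [?|->|?] := triR (pair_max R (a, b)) (pair_max R (a', b')).
- by apply: Or31; left.
- have [?|->|?] := triR a a'.
  + by apply: Or31; right; split=> //; left.
  + have [?|->|?] := triR b b'.
    * by apply: Or31; right; split=> //; right.
    * exact: Or32.
    * by apply: Or33; right; split=> //; right.
  + by apply: Or33; right; split=> //; left.
- by apply: Or33; left.
Qed.

Lemma goedel_segment T (R : T -> T -> Prop) p q :
  (forall x y z, R x y -> R y z -> R x z) -> trichotomous R -> goedel R q p ->
  let S := [set y | R y (pair_max R p) \/ y = pair_max R p] in (S `*` S) q.
Proof.
move=> trR triR Gqp S.
have Sm : S (pair_max R q) by case: Gqp => [?|[]]; [left|right].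
have Sle x : R x (pair_max R q) \/ x = pair_max R q -> S x.
  move=> [Rx|-> //]; left; case: Sm => [|<-//]; exact: trR Rx.
split; apply: Sle; rewrite /pair_max; case: asboolP => Rq; [by left|by right|by right|].
by case: (triR q.1 q.2) => [//|->|]; [right|left].
Qed.

(** Take a counterexample of least cardinality in an initial well-order. If it injected into the
    pairs below some [p], it would inject into the square of a smaller closed segment [S]; this
    square is finite, or no larger than [S] by minimality. *)
Lemma infinite_setX_le T (A : set T) : infinite_set A -> A `*` A #<= A.
Proof.
move=> infA; apply: contrapT => nA.
have [{infA nA}A [infA nA] Amin] :=
  card_min (F := [set A : set T | infinite_set A /\ ~ (A `*` A #<= A)])
    (ex_intro _ A (conj infA nA)).
have NA : [set: A] #<= A by have /card_eqPle[] := card_setT A.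
have AN : A #<= [set: A] by have /card_eqPle[] := card_setT A.
have infN : infinite_set [set: A] by move/(card_le_finite AN).
have [R iR] := initial_wellorder_exists A.
have [_ trR triR wfR _] := iR.
apply: nA; apply: card_le_trans (card_setX_le AN AN) _; apply: card_le_trans (NA).
apply: wo_card_le (goedel_wf wfR) (goedel_tri triR) _ => p _ Np.
pose S := [set y | R y (pair_max R p) \/ y = pair_max R p].
have {}Np : [set: A] #<= S `*` S.
  apply: card_le_trans Np (subset_card_le _) => q [_ /=].
  exact: goedel_segment.
have nNS : ~ ([set: A] #<= S) by exact: initial_segle_lt.
have [finS|infS] := pselect (finite_set S).
  by apply: infN; apply: card_le_finite Np (finite_setX finS finS).
(* Minimality concerns subsets of [T], so [S] is moved there. *)
pose B := val @` S.
have BS : B #<= S by exact: card_image_le.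
have SB : S #<= B.
  apply: (@card_le_fun _ _ _ _ val) => [x Sx|x y _ _ /val_inj//].
  by exists x.
have [nB|/contrapT BB] := pselect (~ (B `*` B #<= B)).
  apply: nNS; apply: card_le_trans NA (card_le_trans (Amin B _) BS).
  by split=> // /(card_le_finite SB).
apply: nNS; apply: card_le_trans Np _.
exact: card_le_trans (card_setX_le SB SB) (card_le_trans BB BS).
Qed.


(** * Unions, power sets and successor cardinals *)

(** Injections [f] of the index set and [g j] of each [E j] place the union in the square of [B],
    which is no larger than [B]. *)
Lemma bigcup_card_le J T U (A : set J) (E : J -> set T) (B : set U) :
  infinite_set B -> A #<= B -> (forall j, A j -> E j #<= B) ->
  \bigcup_(j in A) E j #<= B.
Proof.
move=> infB AB EB; apply: card_le_trans (infinite_setX_le infB).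
have [b Bb] := infinite_setN0 infB.
have [->|/set0P[a Aa]] := eqVneq A set0; first by rewrite bigcup_set0; exact: card_ge0.
have [f fB finj] := card_le_inj (ex_intro _ a Aa) AB.
have /choice[g gP] : forall j, exists g : T -> U, A j -> (forall x, B (g x)) /\
    forall x y, E j x -> E j y -> g x = g y -> x = y.
  move=> j; have [Aj|nAj] := pselect (A j); last by exists (fun=> b).
  have [E0|/set0P[x Ex]] := eqVneq (E j) set0.
    by exists (fun=> b) => _; split=> // x y; rewrite E0.
  have [g gB ginj] := card_le_inj (ex_intro _ x Ex) (EB j Aj).
  by exists g.
apply: (@card_le_rel _ _ _ _
  (fun x p => exists2 j, A j /\ E j x & p = (f j, g j x))).
  move=> x [j Aj Ex]; exists (f j, g j x); last by exists j.
  by split; [exact: fB | have [gB _] := gP j Aj; exact: gB].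
move=> x y p _ _ [j [Aj Ex] ->] [k [Ak Ey] [fjk gxy]].
have {}fjk := finj j k Aj Ak fjk; move: Ey gxy; rewrite -{k Ak}fjk => Ey.
by have [_ ginj] := gP j Aj; exact: ginj.
Qed.

Lemma card_leT_inj T U : [set: T] #<= [set: U] -> exists f : T -> U, injective f.
Proof.
have [T0 _|/set0P[t _] /(card_le_inj (ex_intro _ t Logic.I))[f _ finj]] :=
    eqVneq [set: T] set0; last by exists f => x y; exact: finj.
have T0' (t : T) : False by have : [set: T] t by []; rewrite T0.
by exists (fun t => False_rect U (T0' t)) => t; case: (T0' t).
Qed.

Lemma card_le_powerset T U : [set: T] #<= [set: U] -> [set: set T] #<= [set: set U].
Proof.
move=> /card_leT_inj[f finj].
apply: (@card_le_fun _ _ _ _ (image^~ f)) => // X Y _ _ fXY.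
have sub (Z Z' : set T) : f @` Z = f @` Z' -> Z `<=` Z'.
  move=> fZZ x Zx; have [y Zy fyx] : (f @` Z') (f x) by rewrite -fZZ; exists x.
  by rewrite -(finj y x).
by apply/seteqP; split; apply: sub.
Qed.

Lemma cantor T : ~ ([set: set T] #<= [set: T]).
Proof.
move=> /(card_le_inj (ex_intro _ set0 Logic.I))[f _ finj].
pose S := [set t | exists2 X, f X = t & ~ X t].
have [[X fX nX]|nS] := pselect (S (f S)).
  by apply: (nX); rewrite (finj X S)//; exists X.
by apply: (nS); exists S.
Qed.

(** The successor is the earliest initial segment of a well-order of [set T] that does not inject
    into [T], or all of [set T] if every segment does inject. *)
Lemma succ_exists T : exists M : Type, succ_is T M.
Proof.
have [R [_ trR triR wfR _]] := initial_wellorder_exists (set T).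
have [A [nA minA]] : exists A : set (set T), ~ (A #<= [set: T]) /\
    forall x, A x -> A `&` [set y | R y x] #<= [set: T].
  have [big|small] :=
      pselect (exists x, ~ ([set y | R y x] #<= [set: T])); last first.
    exists setT; split=> [|x _]; first exact: cantor.
    by rewrite setTI; apply: contrapT => nx; apply: small; exists x.
  have [m nm mmin] := wf_min wfR big.
  exists [set y | R y m]; split=> // x /mmin /contrapT.
  by apply: card_le_trans (subset_card_le _) => y [].
exists A; split=> [|N /card_ltPn nN].
  by apply/card_ltPn; rewrite (card_le_eql (card_setT A)).
rewrite (card_le_eql (card_setT A)); apply: wo_card_le wfR triR _ => x Ax NA.
by apply: nN; exact: card_le_trans NA (minA x Ax).
Qed.

(** * Cardinal powers and their bound under SCH *)

(** Keeping the type [I -> T] allows powers of different subsets of [T] to be united. *)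
Definition power I T (A : set T) : set (I -> T) := [set f | forall i, A (f i)].

Arguments power I [T] A.

Lemma power_le I T U (A : set T) (B : set U) :
  A #<= B -> power I A #<= power I B.
Proof.
move=> /card_leP[phi]; apply: (@card_le_rel _ _ _ _
  (fun f g => forall i (a : A), f i = val a -> g i = val (phi a))).
  move=> f Af; exists (fun i => val (phi (SigSub (mem_set (Af i))))).
    by move=> i; exact: set_valP.
  by move=> i a fia; congr (val (phi _)); exact: val_inj.
move=> f f' g Af Af' fg fg'; apply: funext => i.
have := fg i (SigSub (mem_set (Af i))) erefl.
rewrite (fg' i (SigSub (mem_set (Af' i))) erefl) => /val_inj/esym.
by move=> /(@inj _ _ _ phi); rewrite !inE => /(_ Logic.I Logic.I)/(congr1 val).
Qed.

Lemma power_setT I T : power I [set: T] = [set: I -> T].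
Proof. by apply/seteqP; split. Qed.

Lemma power_ord_le n T (B : set T) : infinite_set B -> power 'I_n B #<= B.
Proof.
move=> infB; elim: n => [|n IHn].
  have [b Bb] := infinite_setN0 infB.
  apply: (@card_le_fun _ _ _ _ (fun=> b)) => // f g _ _ _.
  by apply: funext => -[].
apply: card_le_trans (infinite_setX_le infB).
apply: card_le_trans (card_setX_le (card_lexx B) IHn).
apply: (@card_le_fun _ _ _ _ (fun f => (f ord0, fun i => f (lift ord0 i)))).
  by move=> f Bf; split=> [|i]; exact: Bf.
move=> f g _ _ [f0 fS]; apply: funext => i.
have [j ->|->//] := unliftP ord0 i.
by have := congr1 (@^~ j) fS.
Qed.

(** A function on [I] is copied along an injection into [J] and takes the value [b] off the
    image. *)
Lemma power_le_exp I J T (B : set T) : B !=set0 ->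
  [set: I] #<= [set: J] -> power I B #<= power J B.
Proof.
move=> [b Bb] /card_leT_inj[e einj].
apply: (@card_le_rel _ _ _ _ (fun f g => forall i, g (e i) = f i)).
  move=> f Bf; have /choice[g gP] : forall j, exists t, B t /\
      forall i, e i = j -> t = f i.
    move=> j; have [[i ij]|nj] := pselect (exists i, e i = j).
      by exists (f i); split=> [|i']; [exact: Bf | rewrite -ij => /einj ->].
    by exists b; split=> // i ij; case: nj; exists i.
  by exists g => [j|i]; [exact: (gP j).1 | exact: (gP (e i)).2].
by move=> f f' g _ _ fg fg'; apply: funext => i; rewrite -fg fg'.
Qed.

Lemma power_finite_le I T (B : set T) :
  finite_set [set: I] -> infinite_set B -> power I B #<= B.
Proof.
move=> [n In] infB; apply: card_le_trans (power_ord_le n infB).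
apply: power_le_exp; first exact: infinite_setN0.
by have /card_eqPle[] := card_eq_trans In card_II.
Qed.

(** A function [I -> set I] amounts to a subset of [I * I], which is no larger than [I]. *)
Lemma power_powerset_le I : infinite_set [set: I] ->
  [set: I -> set I] #<= [set: set I].
Proof.
move=> infI; apply: (@card_le_trans _ (set (I * I)) _ setT).
  apply: (@card_le_fun _ _ _ _ (fun f => [set p | f p.1 p.2])) => // f g _ _ fg.
  by apply: funext => i; apply/seteqP; split=> j;
    have := congr1 (@^~ (i, j)) fg => /= ->.
apply: card_le_powerset; rewrite -setXTT; exact: infinite_setX_le.
Qed.

(* A function into [A] is determined by its truncations at the points of a
   cofinal set, and there are at most [|A|] truncations at each point. *)
Lemma power_le_cofinal I T (R : T -> T -> Prop) (S : set T) :
  cofinal R S -> (forall x y z, R x y -> R y z -> R x z) ->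
  trichotomous R ->
  (forall s, power I [set y | R y s \/ y = s] #<= [set: T]) ->
  [set: I -> T] #<= [set: S -> T].
Proof.
move=> cofS trR triR small.
pose le x y := R x y \/ x = y.
have /choice[e einj] : forall s, exists e : (I -> T) -> T, forall f g,
    (forall i, le (f i) s) -> (forall i, le (g i) s) -> e f = e g -> f = g.
  move=> s; have [|e _ einj] := card_le_inj _ (small s).
    by exists (fun=> s) => i; right.
  by exists e => f g fs gs; exact: einj.
pose trunc s (f : I -> T) i := if `[< le (f i) s >] then f i else s.
have trunc_le s f i : le (trunc s f i) s.
  by rewrite /trunc; case: asboolP => // _; right.
apply: (@card_le_fun _ _ _ _ (fun f (s : S) => e (val s) (trunc (val s) f))) => //.
move=> f g _ _ fg; apply: funext => i.
have [s [Ss fs gs]] : exists s, [/\ S s, le (f i) s & le (g i) s].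
  have le_trans x y z : le x y -> le y z -> le x z.
    by move=> [Rxy|-> //] [Ryz|<-]; left => //; exact: trR Ryz.
  have [m fm gm] : exists2 m, le (f i) m & le (g i) m.
    have [fg'|fg'|fg'] := triR (f i) (g i).
    - by exists (g i); [left|right].
    - by exists (g i); [right|right].
    - by exists (f i); [right|left].
  by have [s Ss ms] := cofS m; exists s; split=> //; exact: le_trans ms.
have := congr1 (@^~ (SigSub (mem_set Ss))) fg => /= /einj-/(_ (trunc_le s f) (trunc_le s g)).
move=> /(congr1 (@^~ i)); rewrite /trunc.
by case: asboolP => // _; case: asboolP.
Qed.

(** The range of a function on [I] is too small to be cofinal, so some [s] bounds the function
    strictly. This covers all functions by [|T|] sets of size at most [|T|]. *)
Lemma power_noncofinal_le I T (R : T -> T -> Prop) :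
  trichotomous R -> infinite_set [set: T] ->
  (forall S, cofinal R S -> ~ (S #<= [set: I])) ->
  (forall s, power I [set y | R y s] #<= [set: T]) ->
  [set: I -> T] #<= [set: T].
Proof.
move=> triR infT cofR small.
have -> : [set: I -> T] = \bigcup_(s in [set: T]) power I [set y | R y s].
  apply/seteqP; split=> // f _.
  have : ~ cofinal R (range f) by move=> /cofR; apply; exact: card_image_le.
  move=> /existsNP[s sP]; exists s => // i.
  by have [//|fis|Rsf] := triR (f i) s; case: sP; exists (f i); [exists i|right|exists i|left].
exact: bigcup_card_le.
Qed.

(* Under SCH, [nu ^ kappa <= mu] whenever [nu < mu] and [2 ^ kappa < mu]. A
   counterexample [A] of least cardinality [nu] exceeds [2 ^ kappa]. If
   [cf nu > kappa], functions into [A] are bounded, hence few by minimality;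
   otherwise [nu ^ kappa <= nu ^ cf nu = nu ^+]. *)
Lemma SCH_power_le I T U (A : set T) (M : set U) :
  SCH -> ~ (M #<= A) -> infinite_set M -> ~ (M #<= [set: set I]) ->
  power I A #<= M.
Proof.
move=> sch nMA infM nMI.
have [finI|infI] := pselect (finite_set [set: I]).
  apply: card_le_trans (power_le I (card_le_totalP nMA)) _.
  exact: power_finite_le.
apply: contrapT => nA.
(* The bound [N] ranges over all types, so that minimality of [A] can later be applied with [A]
   itself as the bound. *)
pose bad (B : set T) := exists V (N : set V),
  [/\ ~ (N #<= B), ~ (N #<= [set: set I]) & ~ (power I B #<= N)].
have badA : bad A by exists U, M.
have [{nA badA}A [{nMA infM nMI}U [{}M [nMA nMI nA]]] Amin] :=
  card_min (ex_intro bad A badA).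
(* If [|A| <= 2 ^ kappa], then [|A| ^ kappa <= 2 ^ kappa < |M|]. *)
have [AI|nAI] := pselect (A #<= [set: set I]).
  apply: nA; apply: card_le_trans (power_le I AI) _; rewrite power_setT.
  apply: card_le_trans (power_powerset_le infI) _; exact: card_le_totalP.
have NA : [set: A] #<= A by have /card_eqPle[] := card_setT A.
have AN : A #<= [set: A] by have /card_eqPle[] := card_setT A.
have nNI : ~ ([set: A] #<= [set: set I]) by move/(card_le_trans AN).
have INle : [set: set I] #<= [set: A] by exact: card_le_totalP.
have infN : infinite_set [set: A].
  apply: contra_not infI => /(card_le_finite INle); apply: card_le_finite.
  by apply: (@card_le_fun _ _ _ _ set1) => // i j _ _ ij; rewrite -[i = j]/([set j] i) -ij.
have small (Y : set A) : ~ ([set: A] #<= Y) -> power I Y #<= [set: A].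
  move=> nY; pose B := val @` Y.
  have YB : Y #<= B.
    by apply: (@card_le_fun _ _ _ _ val) => [x Yx|x y _ _ /val_inj//]; exists x.
  have BY : B #<= Y by exact: card_image_le.
  apply: card_le_trans (power_le I YB) _; apply: contrapT => nB.
  apply: (nY); apply: card_le_trans NA (card_le_trans (Amin B _) BY).
  by exists A, setT; split=> // /card_le_trans/(_ BY).
apply: nA; apply: card_le_trans (power_le I AN) _; rewrite power_setT.
have [R iR] := initial_wellorder_exists A; have [_ trR triR _ segR] := iR.
have [S cofS Smin] : exists2 S, cofinal R S & forall S', cofinal R S' -> S #<= S'.
  by apply: card_min; exists setT => t; exists t => //; right.
have SS : [set: S] #<= S by have /card_eqPle[] := card_setT S.
(* Here [|S| = cf nu]; the case [cf nu > kappa] is settled first. *)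
have [SI|nSI] := pselect (S #<= [set: I]); last first.
  apply: card_le_trans _ (card_le_trans NA (card_le_totalP nMA)).
  apply: power_noncofinal_le triR infN _ _ => [S' /Smin SS' S'I|s].
    by apply: nSI; exact: card_le_trans SS' S'I.
  by apply: small; apply/card_ltPn.
apply: card_le_trans (power_le_cofinal cofS trR triR _) _ => [s|].
  by apply: small; exact: initial_segle_lt.
have [M0 succM0] := succ_exists A.
have cfA : cf_is A S.
  exists R; split=> //; split=> [|S' cofS'].
    by exists S => //; exact: card_setT_sym.
  exact: card_le_trans SS (Smin S' cofS').
(* The premise of SCH holds because [2 ^ cf nu <= 2 ^ kappa < nu]. *)
have ltS : card_lt [set: set S] [set: A].
  apply/card_ltPn => AS; apply: nNI; apply: card_le_trans AS _.
  by apply: card_le_powerset; exact: card_le_trans SS SI.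
have /card_eqPle[SM0 _] := sch A S M0 infN cfA ltS succM0.
apply: card_le_trans SM0 _.
have MM : [set: M] #<= M by have /card_eqPle[] := card_setT M.
apply: card_le_trans MM; apply: succM0.2; apply/card_ltPn => MA.
apply: nMA; apply: card_le_trans (card_le_trans MA NA).
by have /card_eqPle[] := card_setT M.
Qed.


(** * Dense subsets of an infinite Boolean algebra *)

Lemma finite_powerset T : finite_set [set: T] -> finite_set [set: set T].
Proof.
move=> [n /card_eqPle[Tn _]].
have /card_le_powerset TI : [set: T] #<= [set: 'I_n].
  by apply: card_le_trans Tn _; have /card_eqPle[] := @card_II n.
apply: card_le_finite TI _.
apply: (@card_le_finite _ {set 'I_n} _ setT) (finite_finset).
apply: (@card_le_fun _ _ _ _ (fun Y => [set k | `[< Y k >]]%SET)) => // Y Z _ _.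
move=> /setP YZ; apply/funext => k; apply/propext.
by have := YZ k; rewrite !inE => E; split=> /asboolP H; apply/asboolP;
  [rewrite -E|rewrite E].
Qed.

(** An element is determined by the members of [X] below it, so a finite [X] would leave only
    finitely many elements. *)
Lemma pi_dense_infinite d (B : ctbDistrLatticeType d) (X : set B) :
  pi_dense [set: B] (fun x y => (x <= y)%O) \bot%O X ->
  infinite_set [set: B] -> infinite_set X.
Proof.
move=> [X0 Xd] infB finX; apply: infB.
have /finite_powerset : finite_set [set: X].
  by apply: card_le_finite finX; have /card_eqPle[] := card_setT X.
apply: card_le_finite.
apply: (@card_le_fun _ _ _ _ (fun b => [set x : X | (val x <= b)%O])) => // a b _ _ ab.
have le_of_below (u v : B) :
    [set x : X | (val x <= u)%O] = [set x : X | (val x <= v)%O] -> (u <= v)%O.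
  move=> uv; apply: contrapT => nuv.
  (* A member of [X] below [u] minus [v] lies below [u] and, being nonzero, not below [v]. *)
  have [|x Xx] := Xd (Order.diff u v) Logic.I; first by move/eqP; rewrite diff_eq0.
  rewrite leBRL => /andP[xu /eqP xv0].
  have : [set x : X | (val x <= v)%O] (SigSub (mem_set Xx)) by rewrite -uv.
  move=> /= /meet_idPl xv; have [] := X0 x Xx => _; apply.
  by rewrite /= -xv0 -[LHS]xv.
apply: le_anti; apply/andP; split; exact: le_of_below.
Qed.

(** * Classes modulo an ultrafilter *)

Lemma ueq_refl I (D : set_system I) (F : I -> Type) (f : uprod F) :
  UltraFilter D -> ueq D f f.
Proof. by move=> UD; rewrite /ueq (_ : [set i | _] = setT) ?predeqE//; exact: filterT. Qed.

Lemma uclassP I (D : set_system I) (F : I -> Type) (f g : uprod F) :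
  UltraFilter D -> uclass D f = uclass D g <-> ueq D f g.
Proof.
move=> UD; split=> [fg|fg].
  by have : uclass D g g by [exact: ueq_refl]; rewrite -fg.
rewrite predeqE => h; split=> /= H; rewrite /uclass/ueq/=.
  by apply: filterS2 fg H => i /= <-.
by apply: filterS2 fg H => i /= ->.
Qed.

Lemma ultra_not I (D : set_system I) (P : set I) :
  UltraFilter D -> ~ D P -> D (~` P).
Proof. by move=> UD; have [|] := in_ultra_setVsetC P UD. Qed.

Lemma uclass_neq I (D : set_system I) (F : I -> Type) (f g : uprod F) :
  UltraFilter D -> uclass D f <> uclass D g <-> D [set i | f i <> g i].
Proof.
move=> UD; split=> [fg|Dfg /uclassP fg].
  by apply: ultra_not; apply: contra_not fg => /uclassP.
by have [i []] := filter_ex (filterI Dfg fg).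
Qed.

(** Composition with maps that are injective almost everywhere both preserves and reflects equality
    modulo [D]. *)
Lemma ucarrier_image_card I (D : set_system I) (F G : I -> Type)
    (e : forall i, F i -> G i) :
  UltraFilter D -> D [set i | injective (e i)] ->
  [set uclass D (fun i => e i (f i)) | f in [set: uprod F]] #= ucarrier D F.
Proof.
move=> UD De.
have eP (f g : uprod F) : uclass D f = uclass D g <->
    uclass D (fun i => e i (f i)) = uclass D (fun i => e i (g i)).
  by rewrite !uclassP; split; apply: filterS2 De => i ei; [move=> /= ->|move/ei].
pose r C C' := exists f, C = uclass D f /\ C' = uclass D (fun i => e i (f i)).
apply: Cantor_Bernstein.
  apply: (@card_le_rel _ _ _ _ (fun C' C => r C C')).
    by move=> _ [f _ <-]; exists (uclass D f); exists f.
  by move=> C C' E _ _ [f [-> ->]] [g [/eP fg ->]].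
apply: (@card_le_rel _ _ _ _ r).
  by move=> _ [f ->]; exists (uclass D (fun i => e i (f i))); exists f.
by move=> C C' E _ _ [f [-> ->]] [g [-> /eP fg]].
Qed.


(** * Dense subsets of the ultraproduct *)

Lemma dependent_function_choice I (F : I -> Type) (P : forall i, F i -> Prop) :
  (forall i, exists y, P i y) -> exists f : forall i, F i, forall i, P i (f i).
Proof. by move=> ex; exists (fun i => projT1 (cid (ex i))) => i; case: cid. Qed.

(** Below a nonzero class of [g], choose a member of the given dense set under each nonzero [g i];
    the remaining coordinates are negligible and take any value. *)
Lemma ultraproduct_pi_dense I (D : set_system I) (d : Order.disp_t)
    (A : I -> ctbDistrLatticeType d) (Lam : I -> Type)
    (e : forall i, Lam i -> A i) :
  UltraFilter D -> (forall i, [set: Lam i] !=set0) ->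
  (forall i, pi_dense [set: A i] (fun x y => (x <= y)%O) \bot%O (range (e i))) ->
  pi_dense (ucarrier D A) (@ule I D d A) (ubot D A)
    [set uclass D (fun i => e i (f i)) | f in [set: uprod Lam]].
Proof.
move=> UD Lam0 ed; split.
  move=> _ [f _ <-]; split=> /=; first by exists (fun i => e i (f i)).
  apply/uclass_neq; apply: nearW => i; have [sub _] := ed i.
  by have [|_] := sub (e i (f i)); first by exists (f i).
move=> _ [g ->] /(uclass_neq g _ UD).1 g0.
have /dependent_function_choice[f fP] : forall i, exists l : Lam i, g i <> \bot%O -> (e i l <= g i)%O.
  move=> i; have [g0i|g0i] := pselect (g i = \bot%O).
    by have [l _] := Lam0 i; exists l.
  by have [_ /(_ (g i) Logic.I g0i)[_ [l _ <-] le]] := ed i; exists l.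
exists (uclass D (fun i => e i (f i))); first by exists f.
exists (fun i => e i (f i)), g; split=> //.
by apply: filterS g0 => i; exact: fP.
Qed.

(** Otherwise each [k] lies in [h i] for almost all [i]. The elements [rep k i] with [k] in [h i]
    are too few to be dense, so some nonzero [a i] is above no nonzero one of them, and the class of
    [a] has no member of the dense set below it. *)
Lemma pi_dense_diagonal I (D : set_system I) (d : Order.disp_t)
    (A : I -> ctbDistrLatticeType d) (Lam : I -> Type) K (rep : K -> uprod A)
    (h : forall i, set K) :
  UltraFilter D -> (forall i, piBA (A i) [set: Lam i]) ->
  pi_dense (ucarrier D A) (@ule I D d A) (ubot D A)
    [set uclass D (rep k) | k in [set: K]] ->
  (forall i, ~ ([set: Lam i] #<= h i)) ->
  exists k, D [set i | ~ h i k].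
Proof.
move=> UD piA [X0 Xd] hsmall; apply: contrapT => hk.
have {}hk k : D [set i | h i k].
  apply: contrapT => nh; apply: hk; exists k; exact: ultra_not.
have /dependent_function_choice[a aP] : forall i, exists a : A i, a <> \bot%O /\
    forall k, h i k -> rep k i <> \bot%O -> ~ (rep k i <= a)%O.
  move=> i; apply: contrapT => na; apply: (hsmall i).
  apply: card_le_trans (card_image_le (fun k => rep k i) (h i)).
  (* The bottom is removed because a dense set may not contain it. *)
  apply: card_le_trans (subset_card_le (@subDsetl _ _ [set \bot%O])).
  have [_] := piA i; apply; split; first by move=> x [_ x0].
  move=> a _ a0; apply: contrapT => nx; apply: na; exists a; split=> // k hik k0 ka.
  by apply: nx; exists (rep k i) => //; split=> //; exists k.
have aN0 : uclass D a <> ubot D A by apply/uclass_neq; apply: nearW => i; exact: (aP i).1.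
have [_ [k _ <-] [f [g [/uclassP kf /uclassP ag fg]]]] := Xd _ (ex_intro _ a erefl) aN0.
have [_ /(uclass_neq _ _ UD).1 k0] := X0 _ (ex_intro2 _ _ k Logic.I erefl).
have [i [[[/= kfi agi] /= fgi] [/= k0i hik]]] :=
  filter_ex (filterI (filterI (filterI kf ag) fg) (filterI k0 (hk k))).
by apply: (aP i).2 hik k0i _; rewrite kfi agi.
Qed.

(** Replacing the values beyond the bound [k] by [k] changes a function only on a negligible set and
    makes it bounded everywhere. *)
Lemma ucarrier_card_le_power I (D : set_system I) (Lam : I -> Type) K
    (R : K -> K -> Prop) (e : forall i, Lam i -> K) :
  UltraFilter D -> D [set i | injective (e i)] ->
  (forall f : uprod Lam, exists k, D [set i | R (e i (f i)) k \/ e i (f i) = k]) ->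
  ucarrier D Lam #<= \bigcup_(k in [set: K]) power I [set y | R y k \/ y = k].
Proof.
move=> UD De bounded; apply: (@card_le_rel _ _ _ _
  (fun C g => exists f, C = uclass D f /\ D [set i | g i = e i (f i)])).
  move=> _ [f ->]; have [k Dk] := bounded f.
  exists (fun i => if `[< R (e i (f i)) k \/ e i (f i) = k >] then e i (f i) else k).
    by exists k => // i /=; case: asboolP => // _; right.
  exists f; split=> //; apply: filterS Dk => i fik /=.
  by case: asboolP.
move=> C C' g _ _ [f [-> Df]] [f' [-> Df']]; apply/uclassP.
apply: filterS2 De (filterI Df Df') => i ei [/= -> /esym].
by move/esym/ei.
Qed.

Lemma ultraproduct_pi_ge I (D : set_system I) (d : Order.disp_t)
    (A : I -> ctbDistrLatticeType d) (Lam : I -> Type) X :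
  SCH -> UltraFilter D -> (forall i, piBA (A i) [set: Lam i]) ->
  (forall i, infinite_set [set: Lam i]) ->
  (forall i, card_lt [set: set I] [set: Lam i]) ->
  pi_dense (ucarrier D A) (@ule I D d A) (ubot D A) X ->
  ucarrier D Lam #<= X.
Proof.
move=> sch UD piA infLam ltLam Xd.
have /choice[rep repP] : forall k : X, exists f, val k = uclass D f.
  by move=> k; have [[f]] := Xd.1 (val k) (set_valP k); exists f.
have {}Xd : pi_dense (ucarrier D A) (@ule I D d A) (ubot D A)
    [set uclass D (rep k) | k in [set: X]].
  rewrite (_ : [set _ | _ in _] = X)//; apply/seteqP; split=> [_ [k _ <-]|C XC].
    by rewrite -repP; exact: set_valP.
  by exists (SigSub (mem_set XC)); rewrite -?repP.
have nLam0 i : ~ ([set: Lam i] #<= @set0 X).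
  by move=> /card_le0P L0; apply: (infLam i); rewrite L0.
have DX : D [set i | [set: Lam i] #<= [set: X]].
  apply: contrapT => /ultra_not nDX.
  (* At coordinates where [|X| < lambda_i] all of [X] is avoided, elsewhere nothing. *)
  pose h i := [set k : X | ~ ([set: Lam i] #<= [set: X])].
  have [|k Dk] := pi_dense_diagonal (h := h) UD piA Xd.
    move=> i; have [LX|nLX] := pselect ([set: Lam i] #<= [set: X]).
      by rewrite /h (_ : [set _ | _] = set0)// -subset0 => k.
    by move/card_le_trans/(_ (card_leT _)).
  by have [i [/= ]] := filter_ex (filterI Dk nDX).
have [i0 /= LX0] := filter_ex DX.
have infX : infinite_set [set: X] by move=> /(card_le_finite LX0)/infLam.
have nXI : ~ ([set: X] #<= [set: set I]).
  by move/(card_le_trans LX0); exact/card_ltPn.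
have [R iR] := initial_wellorder_exists X; have [_ _ triR wfR _] := iR.
pose S i := [set k | ~ ([set: Lam i] #<= [set y | R y k])].
(* The least point of [X] has an empty segment, so it lies in every [S i]. *)
have [k0 S0] : exists k0, forall i, S i k0.
  have [k0 _ k0min] := wf_min wfR (infinite_setN0 infX).
  exists k0 => i; rewrite /S /= (_ : [set y | R y k0] = set0)//.
  by rewrite -subset0 => y /k0min/(_ Logic.I).
have /dependent_function_choice[e eP] : forall i, exists e : Lam i -> X,
    (forall l, S i (e l)) /\ ([set: Lam i] #<= [set: X] -> injective e).
  move=> i; have [LX|nLX] := pselect ([set: Lam i] #<= [set: X]); last first.
    by exists (fun=> k0); split=> // l; exact: S0.
  (* The first point outside [S i] has at least [lambda_i] predecessors, all in [S i]; if there is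
     no such point, [S i] is all of [X]. *)
  have LS : [set: Lam i] #<= S i.
    have [nS|S1] := pselect (exists k, ~ S i k).
      have [m /contrapT Lm mmin] := wf_min wfR nS.
      by apply: card_le_trans Lm (subset_card_le _) => y /mmin/contrapT.
    rewrite (_ : S i = setT)// -subTset => k _.
    by apply: contrapT => nSk; apply: S1; exists k.
  have [e eS einj] := card_le_inj (infinite_setN0 (infLam i)) LS.
  by exists e; split=> // _ l l'; exact: einj.
have XX : [set: X] #<= X by have /card_eqPle[] := card_setT X.
apply: card_le_trans XX.
apply: card_le_trans (ucarrier_card_le_power UD _ (R := R) (e := e) _) _.
- by apply: filterS DX => i; exact: (eP i).2.
(* The set avoided at [i] is the segment below [e i (f i)]. It is smaller than [lambda_i] as [e i]
   takes values in [S i], and a [k] almost everywhere outside these segments is the required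
   bound. *)
- move=> f; have [i|k Dk] :=
    pi_dense_diagonal (h := fun i => [set y | R y (e i (f i))]) UD piA Xd.
    exact: (eP i).1.
  exists k; apply: filterS Dk => i /= nR.
  by have [?|?|//] := triR (e i (f i)) k; [left|right].
- apply: bigcup_card_le => // k _.
  by apply: SCH_power_le => //; exact: initial_segle_lt.
Qed.

(* kappa = |I|; lambda_i = |Lam i|; A = prod_i A i / D. *)
Theorem theorem1p1 :
  SCH ->
  forall (I : Type) (D : set_system I), UltraFilter D ->
  forall (d : Order.disp_t) (A : I -> ctbDistrLatticeType d) (Lam : I -> Type),
    (forall i, infinite_set [set: A i]) ->
    (forall i, piBA (A i) [set: Lam i]) ->
    (forall i, card_lt [set: set I] [set: Lam i]) ->
    piUltra D A (ucarrier D Lam).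
Proof.
move=> sch I D UD d A Lam infA piA ltLam.
have /dependent_function_choice[Y YP] : forall i, exists Y : set (A i),
    pi_dense [set: A i] (fun x y => (x <= y)%O) \bot%O Y /\ Y #= [set: Lam i].
  by move=> i; have [[Y Yd YL] _] := piA i; exists Y.
have infLam i : infinite_set [set: Lam i].
  have [Yd /card_eqPle[YL _]] := YP i.
  by move=> /(card_le_finite YL); exact: pi_dense_infinite.
(* The dense set [Y i] is enumerated injectively by [Lam i], so that functions into [Lam] name
   classes of the ultraproduct. *)
have /dependent_function_choice[e eP] : forall i, exists e : Lam i -> A i,
    injective e /\ range e = Y i.
  move=> i; have /card_esym/card_bijP[f [g fK gK]] := (YP i).2.
  pose l (x : Lam i) : [set: Lam i] := SigSub (mem_set (Logic.I : [set: Lam i] x)).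
  exists (fun x => val (f (l x))); split=> [x y /val_inj/(can_inj fK)/(congr1 val)//|].
  apply/seteqP; split=> [_ [x _ <-]|y Yy]; first exact: set_valP.
  exists (val (g (SigSub (mem_set Yy)))) => //.
  by rewrite (_ : l _ = g (SigSub (mem_set Yy))) ?gK//; exact: val_inj.
split; last by move=> X; exact: ultraproduct_pi_ge.
exists [set uclass D (fun i => e i (f i)) | f in [set: uprod Lam]].
  apply: ultraproduct_pi_dense => i; first exact: infinite_setN0.
  by rewrite (eP i).2; exact: (YP i).1.
by apply: ucarrier_image_card; apply: nearW => i; exact: (eP i).1.
Qed.
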